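(* Let $A$ be a real finite-dimensional affine space, $m\in\mathrm{Met}(A)$ a non-null metric, and $\mathrm{CM}_m$ its Cayley–Menger bilinear form on $\mathrm{Aff}(\mathrm{Quad}_mA)$. For any element $\bar v\in\mathrm{Aff}(\mathrm{Quad}_mA)$ and for the quadratic immersion $v:A\to\mathrm{Aff}(\mathrm{Quad}_mA)$, $P\mapsto v_P$, there holds $$\bar v\in\mathrm{Im}\,v\iff \mathrm{CM}_m(\bar v,\bar v)=0\ \text{ and }\ \mathrm{CM}_m(\bar v,v_m)=1.$$
   Context: All spaces are real and finite-dimensional. For an affine space $A$ with director vector space $\vec A$: $\mathrm{Aff}(A)$ is the vector space of affine functions $A\to\mathbb R$, $u$ the constant function $1$. The linear hull is $\widehat A=(\mathrm{Aff}(A))^*$; $z_P\in\widehat A$ is evaluation at $P$; $A$ is identified with $\{z:\langle z,u\rangle=1\}$ and $\vec A$ with $\{z:\langle z,u\rangle=0\}$, $\overrightarrow{PQ}=z_Q-z_P$. A function $\delta:A\to\mathbb R$ is quadratic if $\delta(\alpha P+\beta Q)=\alpha(\alpha-\beta)\delta(P)+\beta(\beta-\alpha)\delta(Q)+4\alpha\beta\,\delta(\frac{P+Q}2)$ whenever $\alpha+\beta=1$ (the same formula defines quadratic maps between affine spaces); $\mathrm{Quad}(A)$ is the vector space of quadratic functions. Each $\delta\in\mathrm{Quad}(A)$ has a symmetric bilinear form $\mathrm{Hess}\,\delta$ on $\vec A$ (hessian principal component), characterized by $\frac12(\delta(Q)+\delta(2P-Q))-\delta(P)=\frac12\mathrm{Hess}\,\delta(\overrightarrow{PQ},\overrightarrow{PQ})$.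 $\mathrm{Met}(A)=\mathrm{Quad}(A)/\mathrm{Aff}(A)$ is the space of metrics; for $m\in\mathrm{Met}(A)$, $\mathrm{Quad}_mA\subset\mathrm{Quad}(A)$ is the class $m$, an affine space with director space $\mathrm{Aff}(A)$; its elements share the same hessian principal component $g$ (that of $m$). $m$ is null if $m=0$. $\mathrm{Aff}(\mathrm{Quad}_mA)$ is the vector space of affine functionals $\mathrm{Quad}_mA\to\mathbb R$. Elements: $v_P(\delta)=\delta(P)$ for $P\in A$, and $v_m(\delta)=1$. $\mathrm d_m:\mathrm{Aff}(\mathrm{Quad}_mA)\to\widehat A$ is given by $\langle\mathrm d_m\bar v,s\rangle=\bar v(\delta+s)-\bar v(\delta)$ for $s\in\mathrm{Aff}(A)$ (any $\delta\in\mathrm{Quad}_mA$). $\mathrm{Aff}_0(\mathrm{Quad}_mA)$ is the subspace of $\bar v$ with $\bar v(\delta+\alpha u)=\bar v(\delta)$ for all $\delta,\alpha$; $\mathrm d_m$ maps it into $\vec A$. For $m\neq0$ the Cayley–Menger form $\mathrm{CM}_m$ is the unique symmetric bilinear form on $\mathrm{Aff}(\mathrm{Quad}_mA)$ with (1) $\mathrm{CM}_m(v_1,v_2)=-g(\mathrm d_mv_1,\mathrm d_mv_2)$ for $v_1,v_2\in\mathrm{Aff}_0(\mathrm{Quad}_mA)$ and (2) $\mathrm{CM}_m(v_P,v_P)=0$ for all $P\in A$. *)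

(* Defs.v *)
From HB Require Import structures.
From mathcomp Require Import all_boot all_order all_algebra.
From mathcomp Require Import generic_quotient ring_quotient.
From mathcomp Require Import boolp classical_sets functions reals.
From mathcomp Require Import ring lra.

Set Implicit Arguments.
Unset Strict Implicit.
Unset Printing Implicit Defensive.

Import Order.TTheory GRing.Theory Num.Theory.

Local Open Scope ring_scope.
Local Open Scope quotient_scope.

(* An affine space with director space V: a nonempty set on which V acts
   simply transitively, vec P Q being the vector from P to Q. *)
HB.mixin Record isAffine (R : realType) (V : lmodType R) A := {
  origin : A;
  translate : A -> V -> A;
  vec : A -> A -> V;
  translate0 : forall P, translate P 0 = P;
  translateD : forall P x y, translate P (x + y) = translate (translate P x) y;
  translate_vec : forall P Q, translate P (vec P Q) = Q;
  vec_translate : forall P x, vec P (translate P x) = x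
}.

#[short(type="affineType")]
HB.structure Definition Affine (R : realType) (V : lmodType R) :=
  {A of isAffine R V A}.

Arguments affineType {R} V.
Arguments origin {R V} A : rename.
Arguments translate {R V A} P x : rename.
Arguments vec {R V A} P Q : rename.

Section AffineSpace.
Context {R : realType} {V : lmodType R} {A : affineType V}.

(* The point a P + b Q; meaningful only if a + b = 1. *)
Definition bary (a b : R) (P Q : A) : A := translate P (b *: vec P Q).

Definition affine_fun (f : A -> R^o) := forall P Q a b, a + b = 1 ->
  f (bary a b P Q) = a * f P + b * f Q.

Definition quadratic_fun (f : A -> R^o) := forall P Q a b, a + b = 1 ->
  f (bary a b P Q) = a * (a - b) * f P + b * (b - a) * f Q
                     + 4 * a * b * f (bary 2^-1 2^-1 P Q).

(* R^o rather than R, so that functions form an lmodType. *)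
Definition affine_pred : {pred A -> R^o} := fun f => `[< affine_fun f >].
Definition quad_pred : {pred A -> R^o} := fun f => `[< quadratic_fun f >].

Lemma affine_submod_closed : submod_closed affine_pred.
Proof.
split=> [|k f g /asboolP hf /asboolP hg].
  by apply/asboolP=> P Q a b _; rewrite /= !mulr0 addr0.
apply/asboolP=> P Q a b ab; rewrite !fctE.
rewrite hf// hg// /GRing.scale/=; ring.
Qed.

Lemma quad_submod_closed : submod_closed quad_pred.
Proof.
split=> [|k f g /asboolP hf /asboolP hg].
  by apply/asboolP=> P Q a b _; rewrite /= !mulr0 !addr0.
apply/asboolP=> P Q a b ab; rewrite !fctE.
rewrite hf// hg// /GRing.scale/=; ring.
Qed.

HB.instance Definition _ :=
  GRing.isSubmodClosed.Build R (A -> R^o) affine_pred affine_submod_closed.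
HB.instance Definition _ :=
  GRing.isSubmodClosed.Build R (A -> R^o) quad_pred quad_submod_closed.

End AffineSpace.

Record aff {R : realType} {V : lmodType R} (A : affineType V) := Aff {
  aff_val :> A -> R^o;
  _ : aff_val \in affine_pred }.
HB.instance Definition _ R V A := [isSub for @aff_val R V A].
HB.instance Definition _ R V A := [Choice of @aff R V A by <:].
HB.instance Definition _ R V A :=
  [SubChoice_isSubLmodule of @aff R V A by <:].

Record quad {R : realType} {V : lmodType R} (A : affineType V) := Quad {
  quad_val :> A -> R^o;
  _ : quad_val \in quad_pred }.
HB.instance Definition _ R V A := [isSub for @quad_val R V A].
HB.instance Definition _ R V A := [Choice of @quad R V A by <:].
HB.instance Definition _ R V A :=
  [SubChoice_isSubLmodule of @quad R V A by <:].

Section AffTheory.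
Context {R : realType} {V : lmodType R} {A : affineType V}.
Implicit Types (f : aff A) (P Q : A) (x y : V).

Lemma affE f P Q a b : a + b = 1 -> f (bary a b P Q) = a * f P + b * f Q.
Proof. by case: f => f /= /asboolP; apply. Qed.

Lemma aff_translateZ f P x a :
  f (translate P (a *: x)) - f P = a * (f (translate P x) - f P).
Proof.
have := @affE f P (translate P x) (1 - a) a (subrK _ _).
by rewrite /bary vec_translate => ->; ring.
Qed.

Lemma aff_translateD f P x y :
  f (translate P (x + y)) - f P
  = (f (translate P x) - f P) + (f (translate P y) - f P).
Proof.
have h2 : 2^-1 + 2^-1 = 1 :> R by rewrite [RHS]splitr mul1r.
have vecE u w : vec (translate P u) (translate P w) = w - u.
  by rewrite -{1}(subrK u w) addrC translateD vec_translate.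
have := @affE f (translate P (2 *: x)) (translate P (2 *: y)) _ _ h2.
rewrite /bary vecE -translateD -scalerBr scalerA mulVf ?pnatr_eq0// scale1r.
have -> : 2 *: x + (y - x) = x + y.
  by rewrite scaler_nat mulr2n addrC addrA subrK addrC.
move=> ->.
have := aff_translateZ f P x 2; have := aff_translateZ f P y 2.
lra.
Qed.

Lemma aff_translate_scalar f P : scalar (fun x => f (translate P x) - f P).
Proof. by move=> a x y; rewrite aff_translateD aff_translateZ. Qed.

End AffTheory.

Definition scalar_pred {R : realType} {U : lmodType R} : {pred U -> R^o} :=
  fun z => `[< scalar z >].

Lemma scalar_submod_closed {R : realType} {U : lmodType R} :
  submod_closed (@scalar_pred R U).
Proof.
split=> [|k f g /asboolP hf /asboolP hg].
  by apply/asboolP=> a x y; rewrite /= mulr0 addr0.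
apply/asboolP=> a x y; rewrite !fctE hf hg /GRing.scale/=; ring.
Qed.

HB.instance Definition _ (R : realType) (U : lmodType R) :=
  GRing.isSubmodClosed.Build R (U -> R^o) (@scalar_pred R U) scalar_submod_closed.

Record dual {R : realType} (U : lmodType R) := Dual {
  dual_val :> U -> R^o;
  _ : dual_val \in scalar_pred }.
HB.instance Definition _ R U := [isSub for @dual_val R U].
HB.instance Definition _ R U := [Choice of @dual R U by <:].
HB.instance Definition _ R U := [SubChoice_isSubLmodule of @dual R U by <:].

Section LinearHull.
Context {R : realType} {V : lmodType R} (A : affineType V).

Definition hull : lmodType R := dual (aff A).

Fact point_eval_subproof (P : A) :
  (fun s : aff A => s P : R^o) \in scalar_pred.
Proof. exact/asboolP. Qed.
Definition point_eval (P : A) : hull := Dual (point_eval_subproof P).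

(* The constant affine function u. *)
Fact aff_unit_subproof : (fun=> 1 : R^o) \in @affine_pred R V A.
Proof. by apply/asboolP=> P Q a b ab; rewrite !mulr1. Qed.
Definition aff_unit : aff A := Aff aff_unit_subproof.

Fact aff_quad_subproof (s : aff A) : (s : A -> R^o) \in quad_pred.
Proof.
apply/asboolP=> P Q a b ab; rewrite !affE//; last by lra.
have -> : a = 1 - b by lra.
by field.
Qed.
Definition aff_quad (s : aff A) : quad A := Quad (aff_quad_subproof s).

Definition quad_affine : {pred quad A} :=
  fun d => (d : A -> R^o) \in affine_pred.

Fact quad_affine_zmod_closed : zmod_closed quad_affine.
Proof.
split=> [|d e hd he]; first exact: (rpred0 (@affine_pred R V A)).
exact: (rpredB hd he).
Qed.
HB.instance Definition _ :=
  GRing.isZmodClosed.Build (quad A) quad_affine quad_affine_zmod_closed.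

(* Quad(A) / Aff(A); Quotient.quot only needs a subgroup. *)
Definition met := Quotient.quot quad_affine.
HB.instance Definition _ := GRing.Zmodule.on met.

End LinearHull.

Section QuadM.
Context {R : realType} {V : lmodType R} {A : affineType V}.

(* The class m as a subset of Quad(A): an affine space over Aff(A). *)
Record quadm (m : met A) := QuadM {
  quadm_val :> quad A;
  _ : \pi_(met A) quadm_val == m }.
HB.instance Definition _ m := [isSub for @quadm_val m].

Context {m : met A}.
Implicit Types (d e : quadm m) (s : aff A).

Fact quadm_origin_subproof : \pi_(met A) (repr m) == m.
Proof. by rewrite reprK. Qed.
Definition quadm_origin : quadm m := QuadM quadm_origin_subproof.

Fact quadm_translate_subproof d s :
  \pi_(met A) (quadm_val d + aff_quad s) == m.
Proof.
case: d => d /= /eqP <-; rewrite -Quotient.idealrBE addrC addKr.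
by case: s.
Qed.
Definition quadm_translate d s : quadm m := QuadM (quadm_translate_subproof d s).

Fact quadm_vec_subproof d e :
  (quadm_val e - quadm_val d : A -> R^o) \in affine_pred.
Proof.
case: d e => d /eqP dm [e /= /eqP em].
have : e == d %[mod met A] by rewrite dm em.
by rewrite -Quotient.idealrBE.
Qed.
Definition quadm_vec d e : aff A := Aff (quadm_vec_subproof d e).

Fact quadm_translate0 d : quadm_translate d 0 = d.
Proof. by do 2![apply: val_inj]; rewrite /= addr0. Qed.

Fact quadm_translateD d s t :
  quadm_translate d (s + t) = quadm_translate (quadm_translate d s) t.
Proof. by do 2![apply: val_inj]; rewrite /= addrA. Qed.

Fact quadm_translate_vec d e : quadm_translate d (quadm_vec d e) = e.
Proof. by do 2![apply: val_inj]; rewrite /= addrC subrK. Qed.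

Fact quadm_vec_translate d s : quadm_vec d (quadm_translate d s) = s.
Proof. by apply: val_inj; rewrite /= addrC addKr. Qed.

HB.instance Definition _ := @isAffine.Build R (aff A) (quadm m)
  quadm_origin quadm_translate quadm_vec quadm_translate0 quadm_translateD
  quadm_translate_vec quadm_vec_translate.

End QuadM.
Arguments quadm {R V A} m.

Section CayleyMenger.
Context {R : realType} {V : lmodType R} {A : affineType V}.

Definition symmetric_bilinear {U : lmodType R} (g : U -> U -> R) :=
  (forall x y, g x y = g y x) /\ (forall x, scalar (g x)).

Definition is_hess (d : quad A) (g : V -> V -> R) :=
  symmetric_bilinear g /\
  forall P Q : A, 2^-1 * (d Q + d (bary 2 (-1) P Q)) - d P
                  = 2^-1 * g (vec P Q) (vec P Q).

(* The unique symmetric bilinear form satisfying is_hess. *)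
Definition hess (d : quad A) : V -> V -> R :=
  xget (fun _ _ => 0) [set g | is_hess d g].

(* Independent of the representative: affine functions have zero Hessian. *)
Definition met_hess (m : met A) : V -> V -> R := hess (repr m).

Section Metric.
Variable m : met A.

Fact quad_eval_subproof (P : A) :
  (fun d : quadm m => d P : R^o) \in affine_pred.
Proof.
apply/asboolP=> d e a b ab.
have -> : a = 1 - b by lra.
rewrite /bary /translate /= !fctE /GRing.scale/=; ring.
Qed.
(* v_P *)
Definition quad_eval (P : A) : aff (quadm m) := Aff (quad_eval_subproof P).

(* v_m *)
Definition quad_unit : aff (quadm m) := aff_unit (quadm m).

Fact aff_diff_subproof (w : aff (quadm m)) :
  (fun s : aff A => w (translate (origin (quadm m)) s)
                    - w (origin (quadm m)) : R^o) \in scalar_pred.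
Proof. by apply/asboolP=> a s t; exact: aff_translate_scalar. Qed.
(* d_m *)
Definition aff_diff (w : aff (quadm m)) : hull A := Dual (aff_diff_subproof w).

Lemma aff_diffE (w : aff (quadm m)) (d : quadm m) (s : aff A) :
  aff_diff w s = w (translate d s) - w d.
Proof.
have := aff_translateD w (origin (quadm m)) (vec (origin (quadm m)) d) s.
rewrite translateD !translate_vec /=; lra.
Qed.

(* Aff_0(Quad_m A) *)
Definition aff0 (w : aff (quadm m)) :=
  forall (d : quadm m) (k : R), w (translate d (k *: aff_unit A)) = w d.

(* A vector vec P Q of V is identified with the element z_Q - z_P of the
   linear hull, where z_P is point_eval P. *)
Definition is_cayley_menger (B : aff (quadm m) -> aff (quadm m) -> R) :=
  [/\ symmetric_bilinear B,
      forall w1 w2, aff0 w1 -> aff0 w2 ->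
        forall P1 Q1 P2 Q2 : A,
          aff_diff w1 = point_eval Q1 - point_eval P1 ->
          aff_diff w2 = point_eval Q2 - point_eval P2 ->
          B w1 w2 = - met_hess m (vec P1 Q1) (vec P2 Q2)
    & forall P, B (quad_eval P) (quad_eval P) = 0].

(* For m != 0 and V finite-dimensional, the unique form satisfying
   is_cayley_menger. *)
Definition cayley_menger : aff (quadm m) -> aff (quadm m) -> R :=
  xget (fun _ _ => 0) [set B | is_cayley_menger B].

End Metric.
End CayleyMenger.
Arguments quad_eval {R V A} m P.
Arguments quad_unit {R V A} m.
Arguments cayley_menger {R V A} m.

(* Main.v *)
Require Import Defs.
From mathcomp Require Import all_boot all_order all_algebra.
From mathcomp Require Import generic_quotient ring_quotient.
From mathcomp Require Import boolp classical_sets functions reals.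
From mathcomp Require Import ring lra.

(** Write g for the hessian of m, v_P for evaluation at P and v_m for the
    constant functional 1, and fix a point O.  Since V is its own bidual, the
    differential of a functional w on Quad_m A has the form
    a z_O + (z_P - z_O), with a = <d_m w, u> and P a point of A.  Two
    functionals with the same differential differ by a constant, hence
      w = v_P + c v_m + (a - 1) v_O                 (eval_decomposition).
    The axioms of a Cayley-Menger form B determine its values on these pieces:
    - B(v_m, v_m) = 0, because d_m v_m = 0 (cm_unit_unit);
    - B(v_P, v_Q) = g(PQ, PQ) / 2, by expanding B at v_Q - v_P, which is in
      Aff_0 and has differential z_Q - z_P (cm_eval_eval);
    - B(v_P, v_m) = 1, because g(x, x) v_m = v_(P+x) + v_(P-x) - 2 v_P, so that
      pairing with v_P gives g(x, x) B(v_P, v_m) = g(x, x), and because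
      g(x, x) does not vanish for every x when m != 0 (cm_eval_unit).
    Therefore B(w, v_m) = a, so the second condition says w = v_P + c v_m, and
    then B(w, w) = 2 c, so the first one says c = 0.

    The forms named hess and cayley_menger are chosen among the forms that
    satisfy their axioms, so such forms have to be exhibited.

    For the hessian, the point is that a quadratic function f has affine
    increments P |-> f(P + y) - f(P) (quad_increment_affine), which makes the
    polarization of f bilinear.

    For the Cayley-Menger form, the class m contains the function
    delta(P) = g(OP, OP) / 2 (normal_form).  Let a_i = <d_m w_i, u> and let
    x_i be the vector part of d_m w_i.  Then
      B(w1, w2) = w1(delta) a2 + w2(delta) a1 - g(x1, x2)
    is a Cayley-Menger form (cm_form_cayley_menger). *)

Import Order.TTheory GRing.Theory Num.Theory.
Local Open Scope classical_set_scope.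
Local Open Scope ring_scope.

(** * Symmetric bilinear forms *)

Section Bilinear.
Context {R : realType} {U : lmodType R} {g : U -> U -> R} (g_bilin : symmetric_bilinear g).

Lemma bilinC x y : g x y = g y x. Proof. by case: g_bilin. Qed.

Lemma bilinDr x y z : g x (y + z) = g x y + g x z.
Proof. by case: g_bilin => _ /(_ x 1 y z); rewrite scale1r mul1r. Qed.

Lemma bilin0r x : g x 0 = 0.
Proof. by have := bilinDr x 0 0; rewrite addr0; lra. Qed.

Lemma bilinZr a x y : g x (a *: y) = a * g x y.
Proof. by case: g_bilin => _ /(_ x a y 0); rewrite bilin0r !addr0. Qed.

Lemma bilinNr x y : g x (- y) = - g x y.
Proof. by rewrite -scaleN1r bilinZr mulN1r. Qed.

Lemma bilinDl x y z : g (x + y) z = g x z + g y z.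
Proof. by rewrite !(bilinC _ z) bilinDr. Qed.

Lemma bilinZl a x y : g (a *: x) y = a * g x y.
Proof. by rewrite !(bilinC _ y) bilinZr. Qed.

Lemma bilinNl x y : g (- x) y = - g x y.
Proof. by rewrite !(bilinC _ y) bilinNr. Qed.

Lemma bilinBr x y z : g x (y - z) = g x y - g x z.
Proof. by rewrite bilinDr bilinNr. Qed.

Lemma bilinBl x y z : g (x - y) z = g x z - g y z.
Proof. by rewrite bilinDl bilinNl. Qed.

End Bilinear.

(** * Vectors and barycentres *)

Section AffineGeometry.
Context {R : realType} {V : lmodType R} {A : affineType V}.
Implicit Types (P Q : A) (x y : V).

Lemma vecC P Q S : vec P Q + vec Q S = vec P S.
Proof.
by rewrite -(vec_translate P (vec P Q + vec Q S)) translateD !translate_vec.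
Qed.

Lemma vecxx P : vec P P = 0.
Proof. by apply: (addrI (vec P P)); rewrite vecC addr0. Qed.

Lemma vecB O P Q : vec P Q = vec O Q - vec O P.
Proof. by rewrite -(vecC O P Q) addrC addKr. Qed.

Lemma vec_bary O a b P Q :
  vec O (bary a b P Q) = vec O P + b *: vec P Q.
Proof. by rewrite /bary -(vecC O P) vec_translate. Qed.

Lemma vec_inj O : injective (vec O : A -> V).
Proof. by move=> P Q e; rewrite -(translate_vec O P) e translate_vec. Qed.

Lemma bary_translate a b P Q y :
  translate (bary a b P Q) y = bary a b (translate P y) (translate Q y).
Proof.
apply: (vec_inj P); rewrite vec_bary -(vecC P (bary a b P Q)) vec_bary.
rewrite !vec_translate vecxx add0r addrC; congr (_ + _ *: _).
by rewrite [RHS](vecB P) -(vecC P Q (translate Q y)) !vec_translate addrK.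
Qed.

(** * Quadratic functions and their hessians *)

Lemma aff_increment (f : aff A) P Q x :
  f (translate P x) - f P = f (translate Q x) - f Q.
Proof.
have := aff_translateD f P (vec P Q) x.
rewrite translateD translate_vec; lra.
Qed.

(** On a line a quadratic function is a polynomial of degree at most 2 in the
    parameter; this instance of the barycentric identity has weights -1/2 and
    3/2 at P and P + 2x. *)
Lemma quad_third_difference (f : quad A) P x :
  f (translate P (3 *: x))
  = 3 * f (translate P (2 *: x)) - 3 * f (translate P x) + f P.
Proof.
case: f => f /= /asboolP /(_ P (translate P (2 *: x)) (- 2^-1) (3 * 2^-1)).
rewrite /bary vec_translate !scalerA mulfVK ?pnatr_eq0//.
rewrite mulVf ?pnatr_eq0// scale1r => ->; last by field.
by field.
Qed.

(** Vanishing third differences along lines kill the terms of degree 3 and 4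
    in the plane spanned by x and y: they tie the nine values of f on a 3 x 3
    grid by two linear relations, whose difference is this identity. *)
Lemma quad_increment_midpoint (f : quad A) P x y :
  2 * (f (translate P (x + y)) - f (translate P x))
  = (f (translate P y) - f P)
    + (f (translate P (2 *: x + y)) - f (translate P (2 *: x))).
Proof.
(* Steps of 1/2 in the direction y put the four corners of the parallelogram,
   and the midpoints of its sides, at integer coordinates. *)
pose F (i j : R) : R := f (translate P (i *: x + (2^-1 * j) *: y)).
have line i0 j0 i1 j1 i2 j2 i3 j3 :
    i2 = i0 + 2 * (i1 - i0) -> j2 = j0 + 2 * (j1 - j0) ->
    i3 = i0 + 3 * (i1 - i0) -> j3 = j0 + 3 * (j1 - j0) ->
    F i3 j3 = 3 * F i2 j2 - 3 * F i1 j1 + F i0 j0.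
  have E c : F (i0 + c * (i1 - i0)) (j0 + c * (j1 - j0))
      = f (translate (translate P (i0 *: x + (2^-1 * j0) *: y))
          (c *: ((i1 - i0) *: x + (2^-1 * (j1 - j0)) *: y))).
    rewrite -translateD /F scalerDr !scalerA addrACA -!scalerDl.
    by congr (f (translate P (_ + _ *: _))); ring.
  move=> -> -> -> ->; have := E 1; rewrite !mul1r scale1r ![_ + (_ - _)]addrC.
  by rewrite !subrK => E1; rewrite !E E1 quad_third_difference.
have F00 : F 0 0 = f P by rewrite /F mulr0 !scale0r addr0 translate0.
have F10 : F 1 0 = f (translate P x).
  by rewrite /F mulr0 scale0r addr0 scale1r.
have F20 : F 2 0 = f (translate P (2 *: x)).
  by rewrite /F mulr0 scale0r addr0.
have hy : (2^-1 * 2) *: y = y by rewrite mulVf ?scale1r// pnatr_eq0.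
have F02 : F 0 2 = f (translate P y) by rewrite /F hy scale0r add0r.
have F12 : F 1 2 = f (translate P (x + y)) by rewrite /F hy scale1r.
have F22 : F 2 2 = f (translate P (2 *: x + y)) by rewrite /F hy.
rewrite -F00 -F10 -F20 -F02 -F12 -F22.
clearbody F.
(* The diagonals through (0,1), (1,2) and through (0,1), (1,0); their outer
   points are extrapolated from the horizontal and vertical sides. *)
have d1 : F 2 3 = 3 * F 1 2 - 3 * F 0 1 + F (-1) 0 by apply: line; ring.
have d2 : F 2 (-1) = 3 * F 1 0 - 3 * F 0 1 + F (-1) 2 by apply: line; ring.
have r1 : F 2 3 = 3 * F 2 2 - 3 * F 2 1 + F 2 0 by apply: line; ring.
have r2 : F 2 (-1) = 3 * F 2 0 - 3 * F 2 1 + F 2 2 by apply: line; ring.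
have l1 : F (-1) 0 = 3 * F 0 0 - 3 * F 1 0 + F 2 0 by apply: line; ring.
have l2 : F (-1) 2 = 3 * F 0 2 - 3 * F 1 2 + F 2 2 by apply: line; ring.
lra.
Qed.

(** With f quadratic on the lines PQ and (P + y)(Q + y), the increment
    satisfies the quadratic identity between P and Q; by
    [quad_increment_midpoint] its value at the midpoint is the average of
    those at the ends, and the quadratic identity becomes the affine one. *)
Lemma quad_increment_affine (f : quad A) y :
  (fun P => f (translate P y) - f P : R^o) \in affine_pred.
Proof.
apply/asboolP => P Q a b ab; rewrite bary_translate.
have mid := quad_increment_midpoint f P (2^-1 *: vec P Q) y.
rewrite scalerA mulfV ?pnatr_eq0// scale1r in mid.
rewrite !translateD -[translate P (2^-1 *: _)]/(bary 2^-1 2^-1 P Q) in mid.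
rewrite bary_translate translate_vec in mid.
case: f mid => f /= /asboolP quad_f mid.
rewrite (quad_f P Q) // (quad_f (translate P y) (translate Q y)) //.
have -> : a = 1 - b by lra.
move: mid; set M := f (bary _ _ (translate _ _) _); set N := f (bary _ _ _ _).
move=> mid; have -> : M = N + 2^-1 * ((f (translate P y) - f P)
    + (f (translate Q y) - f Q)) by lra.
by field.
Qed.

(** The polarization g x y = d(O+x+y) - d(O+x) - d(O+y) + d(O) is symmetric,
    and linear in x because it is the linear part of an affine increment. *)
Lemma hess_exists (d : quad A) : exists g, is_hess d g.
Proof.
pose O := origin A.
pose D y : aff A := Aff (quad_increment_affine d y).
pose g x y : R := D y (translate O x) - D y O.
have gC x y : g x y = g y x.
  by rewrite /g /D /= -!translateD (addrC y); ring.
exists g; split; first split => //.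
  by move=> x a y z; rewrite !(gC x) /g aff_translate_scalar.
move=> P Q; set x := vec P Q.
have := aff_increment (D x) O (translate P (-1 *: x)) x.
rewrite -/(g x x) => ->; rewrite /bary -/x /D /= -!translateD scaleN1r.
rewrite !(addNr, addrA) add0r translate0 /x translate_vec.
by field.
Qed.

Lemma hessP (d : quad A) : is_hess d (hess d).
Proof. exact: (@xgetPex _ _ [set g | is_hess d g] (hess_exists d)). Qed.

(** The hessian measures how far d is from being affine at midpoints. *)
Lemma hess_midpoint (d : quad A) (g : V -> V -> R) P Q : is_hess d g ->
  d (bary 2^-1 2^-1 P Q)
  = 2^-1 * (d P + d Q) - 8^-1 * g (vec P Q) (vec P Q).
Proof.
move=> [g_bilin /(_ (bary 2^-1 2^-1 P Q) Q)].
have half : vec (bary 2^-1 2^-1 P Q) Q = 2^-1 *: vec P Q.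
  rewrite (vecB P) vec_bary vecxx add0r -{1}(scale1r (vec P Q)) -scalerBl.
  by congr (_ *: _); field.
have -> : bary 2 (-1) (bary 2^-1 2^-1 P Q) Q = P.
  apply: (vec_inj P); rewrite vec_bary half vec_bary vecxx add0r scaleN1r.
  by rewrite subrr.
rewrite half (bilinZr g_bilin) (bilinZl g_bilin).
lra.
Qed.

(** A quadratic function that is affine at midpoints is affine, since
    a (a - b) + 2 a b = a when a + b = 1. *)
Lemma hess0_affine (d : quad A) (g : V -> V -> R) :
  is_hess d g -> (forall x, g x x = 0) -> (d : A -> R^o) \in affine_pred.
Proof.
move=> d_g g0; apply/asboolP => P Q a b ab.
have mid := hess_midpoint d _ P Q d_g; rewrite g0 mulr0 subr0 in mid.
case: d d_g mid => d /= /asboolP quad_d _ mid; rewrite quad_d// mid.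
have -> : a = 1 - b by lra.
by field.
Qed.

Lemma is_hessB (d e : quad A) (g h : V -> V -> R) :
  is_hess d g -> is_hess e h -> is_hess (d - e) (fun x y => g x y - h x y).
Proof.
move=> [gB gE] [hB hE]; split; first split.
- by move=> x y; rewrite (bilinC gB) (bilinC hB).
- by move=> x a y z; rewrite (bilinDr gB) (bilinDr hB) (bilinZr gB) (bilinZr hB);
    ring.
move=> P Q; have := gE P Q; have := hE P Q; rewrite /= !fctE; lra.
Qed.

(** * The hessian and the normal form of a metric *)

Section SquaredNorm.
Context (g : V -> V -> R) (g_bilin : symmetric_bilinear g) (O : A).

Fact square_subproof :
  (fun P => 2^-1 * g (vec O P) (vec O P) : R^o) \in quad_pred.
Proof.
apply/asboolP => P Q a b ab; have -> : a = 1 - b by lra.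
rewrite !vec_bary (vecB O P Q).
rewrite !(bilinDl g_bilin, bilinDr g_bilin, bilinZl g_bilin, bilinZr g_bilin,
  bilinNl g_bilin, bilinNr g_bilin).
rewrite (bilinC g_bilin (vec O Q) (vec O P)).
by field.
Qed.
Definition square : quad A := Quad square_subproof.

Lemma is_hess_square : is_hess square g.
Proof.
split=> // P Q; rewrite /= !vec_bary (vecB O P Q).
rewrite !(bilinDl g_bilin, bilinDr g_bilin, bilinZl g_bilin, bilinZr g_bilin,
  bilinNl g_bilin, bilinNr g_bilin).
rewrite (bilinC g_bilin (vec O Q) (vec O P)).
by field.
Qed.

End SquaredNorm.

Lemma met_hess_bilin (m : met A) : symmetric_bilinear (met_hess m).
Proof. by have [] := hessP (repr m). Qed.

(* hessian 0 *)
(** This is where non-nullity of the metric enters: a metric whose quadratic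
    form vanishes has an affine representative. *)
Lemma met_hess_neq0 (m : met A) : m != 0 -> exists x, met_hess m x x != 0.
Proof.
move=> m0; apply: contrapT => /forallNP g0; case/negP: m0.
rewrite -(reprK m) -(raddf0 (\pi_(met A))%qT) -Quotient.idealrBE subr0.
apply: (hess0_affine _ _ (hessP (repr m))) => x.
by apply/eqP/negPn/negP; exact: g0.
Qed.

Lemma quadm_hess (m : met A) (d : quadm m) : is_hess d (met_hess m).
Proof.
split=> [|P Q]; first exact: met_hess_bilin.
have [_ /(_ P Q) <-] := hessP (repr m).
pose s := vec (origin (quadm m)) d.
have dE S : d S = repr m S + s S by rewrite /s /= !fctE; ring.
have h21 : 2 + -1 = 1 :> R by ring.
have := affE s P Q h21; rewrite !dE; lra.
Qed.

(** The half square of the distance to O has the same hessian as the chosen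
    representative of m, so the two differ by an affine function. *)
Section NormalForm.
Variables (m : met A) (O : A).

Fact normal_form_subproof :
  \pi_(met A)%qT (square (met_hess m) (met_hess_bilin m) O) == m.
Proof.
rewrite -[X in _ == X](reprK m) -Quotient.idealrBE.
apply: hess0_affine (is_hessB _ _ _ _ (is_hess_square _ _ _) (hessP _)) _ => x.
by rewrite subrr.
Qed.
Definition normal_form : quadm m := QuadM normal_form_subproof.

End NormalForm.

Lemma scalar_sum (U : lmodType R) (f : U -> R) I (r : seq I) (c : I -> R)
    (v : I -> U) :
  scalar f -> f (\sum_(i <- r) c i *: v i) = \sum_(i <- r) c i * f (v i).
Proof.
move=> f_lin; elim: r => [|i r IHr]; last by rewrite !big_cons f_lin IHr.
by rewrite !big_nil; have := f_lin 1 0 0; rewrite scaler0 addr0; lra.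
Qed.

(** * Values of a Cayley-Menger form *)

Section CayleyMengerForm.
Variables (m : met A).
Notation g := (met_hess m).
Notation vm := (quad_unit m).
Notation v := (quad_eval m).

Lemma aff_diff_linear a (w1 w2 : aff (quadm m)) :
  aff_diff (a *: w1 + w2) = a *: aff_diff w1 + aff_diff w2.
Proof.
apply: val_inj; apply/funext => s /=.
by rewrite !fctE /GRing.scale /= /GRing.scale /=; ring.
Qed.

Lemma aff_diff_unit : aff_diff vm = 0.
Proof. by apply: val_inj; apply/funext => s /=; rewrite subrr. Qed.

Lemma aff_diff_eval P : aff_diff (v P) = point_eval P.
Proof.
by apply: val_inj; apply/funext => s /=; rewrite !fctE; ring.
Qed.

Lemma aff_diff_evalB P Q : aff_diff (v Q - v P) = point_eval Q - point_eval P.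
Proof.
have := aff_diff_linear (-1) (v P) (v Q).
by rewrite !aff_diff_eval !scaleN1r ![- _ + _]addrC.
Qed.

Lemma aff0_unit : aff0 vm. Proof. by []. Qed.

Lemma aff0_evalB P Q : aff0 (v Q - v P).
Proof. by move=> d k; rewrite /= !fctE /= !fctE /GRing.scale /=; ring. Qed.

(** A second difference annihilates affine functions, so it takes one and the
    same value on all of the class m, which the hessian provides. *)
Lemma eval_second_difference P x :
  v (translate P x) + v (translate P (- x)) = 2 *: v P + g x x *: vm.
Proof.
apply: val_inj; apply/funext => d.
rewrite /= !fctE /GRing.scale /=.
have [_ /(_ P (translate P x))] := quadm_hess m d.
rewrite /bary !vec_translate scaleN1r; lra.
Qed.

Section Uniqueness.
Context {B : aff (quadm m) -> aff (quadm m) -> R}.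
Hypothesis B_CM : is_cayley_menger B.

Let B_bilin : symmetric_bilinear B. Proof. by case: B_CM. Qed.

Lemma cm_eval_eval P Q : B (v P) (v Q) = 2^-1 * g (vec P Q) (vec P Q).
Proof.
case: B_CM => _ B_g B_null.
have := B_g _ _ (aff0_evalB P Q) (aff0_evalB P Q) _ _ _ _
  (aff_diff_evalB P Q) (aff_diff_evalB P Q).
rewrite !(bilinBl B_bilin, bilinBr B_bilin) !B_null (bilinC B_bilin (v Q)).
lra.
Qed.

Lemma cm_unit_unit : B vm vm = 0.
Proof.
case: B_CM => _ B_g _; pose O := origin A.
have O0 : aff_diff vm = point_eval O - point_eval O.
  by rewrite aff_diff_unit subrr.
rewrite (B_g _ _ aff0_unit aff0_unit _ _ _ _ O0 O0) vecxx.
by rewrite (bilin0r (met_hess_bilin m)) oppr0.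
Qed.

(** The values of B on Aff_0 only show that this does not depend on P;
    [eval_second_difference] normalizes it, up to division by some nonzero
    g(x, x). *)
Lemma cm_eval_unit P : m != 0 -> B (v P) vm = 1.
Proof.
move=> /met_hess_neq0 [x gx]; apply: (mulfI gx).
rewrite -(bilinZr B_bilin) mulr1.
have -> : g x x *: vm
    = v (translate P x) + v (translate P (- x)) - 2 *: v P.
  by rewrite eval_second_difference addrC addKr.
rewrite (bilinBr B_bilin) (bilinDr B_bilin) (bilinZr B_bilin) !cm_eval_eval.
rewrite !vec_translate vecxx !(bilinNl (met_hess_bilin m)).
rewrite !(bilinNr (met_hess_bilin m)) (bilin0r (met_hess_bilin m)).
by field.
Qed.

End Uniqueness.
End CayleyMengerForm.

End AffineGeometry.

(** * Finite dimension: the linear hull and the existence of the form *)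

Section FiniteDimension.
Context {R : realType} {V : vectType R} {A : affineType V}.
Variable O : A.
Implicit Types (z : hull A) (s : aff A).

Let e := vbasis {:V}.

Fact coord_aff_subproof (i : 'I_(\dim {:V})) :
  (fun P : A => coord e i (vec O P) : R^o) \in affine_pred.
Proof.
apply/asboolP => P Q a b ab.
rewrite vec_bary (vecB O P Q) linearD linearZ linearB /=.
by have -> : a = 1 - b; [lra | ring].
Qed.
Definition coord_aff i : aff A := Aff (coord_aff_subproof i).

Lemma aff_coordE s : s = s O *: aff_unit A
  + \sum_(i < \dim {:V}) (s (translate O e`_i) - s O) *: coord_aff i.
Proof.
apply: val_inj; apply/funext => P; rewrite /= !fctE /GRing.scale /= mulr1.
have /asboolP eval_lin := point_eval_subproof P.
have -> := scalar_sum _ (fun s : aff A => s P) _ (index_enum 'I_(\dim {:V}))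
  (fun i => s (translate O e`_i) - s O) coord_aff eval_lin.
have := scalar_sum _ _ _ (index_enum 'I_(\dim {:V})) (fun i => coord e i (vec O P))
  (fun i => e`_i) (aff_translate_scalar s O).
rewrite -coord_vbasis ?memvf// translate_vec /= => sE.
rewrite -[LHS](subrK (s O)) sE addrC; congr (_ + _).
by apply: eq_bigr => i _; rewrite mulrC.
Qed.

(** The component in V of an element of the linear hull, relative to the
    splitting of the hull into V and the line through z_O. *)
Definition hull_vec z : V := \sum_(i < \dim {:V}) z (coord_aff i) *: e`_i.

Lemma hull_vec_linear a z1 z2 :
  hull_vec (a *: z1 + z2) = a *: hull_vec z1 + hull_vec z2.
Proof.
rewrite /hull_vec scaler_sumr -big_split /=; apply: eq_bigr => i _.
by rewrite scalerA -scalerDl.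
Qed.

Lemma hull_vec_point P : hull_vec (point_eval P) = vec O P.
Proof. by rewrite [RHS](coord_vbasis (memvf _)). Qed.

(** z = <z, u> z_O + (z_(O+x) - z_O) with x the vector part of z: this is the
    biduality that requires V to be finite-dimensional. *)
Lemma hull_vecE z s :
  z s = z (aff_unit A) * s O + (s (translate O (hull_vec z)) - s O).
Proof.
have /asboolP z_lin : (z : _ -> R^o) \in scalar_pred by case: z.
rewrite {1}[s]aff_coordE z_lin (mulrC _ (s O)) scalar_sum//; congr (_ + _).
have -> := scalar_sum _ _ _ (index_enum 'I_(\dim {:V})) (fun i => z (coord_aff i))
  (fun i => e`_i) (aff_translate_scalar s O).
by apply: eq_bigr => i _; rewrite mulrC.
Qed.

Variable m : met A.
Notation g := (met_hess m).
Notation vm := (quad_unit m).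
Notation v := (quad_eval m).
Notation d0 := (normal_form m O).

(** In the normal form d0 of the metric, with coordinates
    (w(d0), <d_m w, u>, vector part of d_m w) for w, the form is a hyperbolic
    plane in the first two coordinates plus -g in the third. *)
Definition cm_form (w1 w2 : aff (quadm m)) : R :=
  w1 d0 * aff_diff w2 (aff_unit A) + w2 d0 * aff_diff w1 (aff_unit A)
  - g (hull_vec (aff_diff w1)) (hull_vec (aff_diff w2)).

Lemma cm_form_cayley_menger : is_cayley_menger cm_form.
Proof.
have gB := met_hess_bilin m.
split; first split.
- by move=> w1 w2; rewrite /cm_form (bilinC gB); ring.
- move=> w1 a w2 w3.
  rewrite /cm_form !aff_diff_linear hull_vec_linear.
  by rewrite (bilinDr gB) (bilinZr gB) /= !fctE /GRing.scale /=; ring.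
- move=> w1 w2 w1_0 w2_0 P1 Q1 P2 Q2 w1E w2E.
  have unit0 (w : aff (quadm m)) : aff0 w -> aff_diff w (aff_unit A) = 0.
    by move=> /(_ d0 1); rewrite scale1r (aff_diffE w d0) => ->; rewrite subrr.
  have vecE P Q : hull_vec (point_eval Q - point_eval P) = vec P Q.
    have := hull_vec_linear (-1) (point_eval P) (point_eval Q).
    by rewrite !hull_vec_point !scaleN1r ![- _ + _]addrC -vecB.
  by rewrite /cm_form !unit0// w1E w2E !vecE !mulr0 !add0r.
- by move=> P; rewrite /cm_form aff_diff_eval hull_vec_point /=; field.
Qed.

Lemma cayley_mengerP : is_cayley_menger (cayley_menger m).
Proof.
apply: (@xgetPex _ _ [set B | is_cayley_menger B]).
by exists cm_form; exact: cm_form_cayley_menger.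
Qed.

(** Both sides have the same differential; the constant c makes them agree at
    one function of the class. *)
Lemma eval_decomposition (w : aff (quadm m)) : exists P c,
  w = v P + c *: vm + (aff_diff w (aff_unit A) - 1) *: v O.
Proof.
set a := aff_diff w _; pose o := origin (quadm m).
pose P := translate O (hull_vec (aff_diff w)).
exists P, (w o - o P - (a - 1) * o O).
apply: val_inj; apply/funext => d; rewrite -(translate_vec o d).
move: (vec o d) => s; have := aff_diffE w o s; rewrite hull_vecE -/a -/P.
rewrite /= !fctE /= !fctE /GRing.scale /=; lra.
Qed.

End FiniteDimension.

Theorem theorem5p22 (R : realType) (V : vectType R) (A : affineType V)
    (m : met A) (hm : m != 0) (w : aff (quadm m)) :
  range (quad_eval m) w <->
  cayley_menger m w w = 0 /\ cayley_menger m w (quad_unit m) = 1.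
Proof.
have CM := cayley_mengerP (origin A) m.
have [B_bilin _ B_null] := CM.
split=> [[P _ <-]|[w_null w_unit]]; first by rewrite B_null cm_eval_unit.
have [P [c wE]] := eval_decomposition (origin A) m w.
exists P => //; set a := _ - 1 in wE.
rewrite wE !(bilinDl B_bilin, bilinZl B_bilin) (cm_unit_unit _ CM) in w_unit.
rewrite !(cm_eval_unit _ CM _ hm) in w_unit.
have a0 : a = 0 by lra.
rewrite a0 scale0r addr0 in wE.
rewrite wE !(bilinDl B_bilin, bilinZl B_bilin, bilinDr B_bilin,
  bilinZr B_bilin) (cm_unit_unit _ CM) B_null in w_null.
rewrite (bilinC B_bilin (quad_unit m)) !(cm_eval_unit _ CM _ hm) in w_null.
have c0 : c = 0 by lra.
by rewrite wE c0 scale0r addr0.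
Qed.
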